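(* Let $p,q\in\mathcal{P}(\mathbb{R}^n)$ with conjugate exponents $p',q'$. Then there are constants $c_1,c_2>0$ such that for every $(f_j)_{j\in\mathbb{N}_0}\in\ell^{q(\cdot)}(L^{p(\cdot)})$, $$c_1\big\|(f_j)_{j\in\mathbb{N}_0}\big\|_{\ell^{q(\cdot)}(L^{p(\cdot)})}\le\sup_{(g_j)_{j\in\mathbb{N}_0}\in U_{p',q'}}\int_{\mathbb{R}^n}\sum_{j=0}^\infty|f_j(x)||g_j(x)|\,dx\le c_2\big\|(f_j)_{j\in\mathbb{N}_0}\big\|_{\ell^{q(\cdot)}(L^{p(\cdot)})},$$ where $U_{p',q'}$ is the set of all $(g_j)_{j\in\mathbb{N}_0}\in\ell^{q'(\cdot)}(L^{p'(\cdot)})$ with $\|(g_j)_{j\in\mathbb{N}_0}\|_{\ell^{q'(\cdot)}(L^{p'(\cdot)})}\le1$.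
   Context: $\mathcal{P}(\mathbb{R}^n)$ is the set of measurable functions $p:\mathbb{R}^n\to[1,\infty]$. The conjugate exponent $p'\in\mathcal{P}(\mathbb{R}^n)$ is defined by $\frac1{p(x)}+\frac1{p'(x)}=1$, with $1/\infty=0$. Put $\omega_p(t)=t^p$ if $p\in[1,\infty)$; for $p=\infty$, $\omega_\infty(t)=0$ if $0\le t\le1$ and $\omega_\infty(t)=\infty$ if $t>1$. For measurable $f$ on $\mathbb{R}^n$, $\varrho_{p(\cdot)}(f)=\int_{\mathbb{R}^n}\omega_{p(x)}(|f(x)|)\,dx$. For a sequence $(f_j)_{j\in\mathbb{N}_0}$ of measurable functions on $\mathbb{R}^n$, $\varrho_{\ell^{q(\cdot)}(L^{p(\cdot)})}((f_j)_j)=\sum_{j=0}^\infty\inf\{\lambda_j>0:\varrho_{p(\cdot)}(f_j/\lambda_j^{1/q(\cdot)})\le1\}$ (with $\lambda^{1/\infty}=1$ and $\inf\emptyset=\infty$), and $\|(f_j)_j\|_{\ell^{q(\cdot)}(L^{p(\cdot)})}=\inf\{\mu>0:\varrho_{\ell^{q(\cdot)}(L^{p(\cdot)})}((f_j/\mu)_j)\le1\}$. The space $\ell^{q(\cdot)}(L^{p(\cdot)})$ consists of the sequences for which this quantity is finite. *)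

(* Defs.v *)
From HB Require Import structures.
From mathcomp Require Import all_boot all_order all_algebra.
From mathcomp Require Import all_classical all_reals all_analysis.
From mathcomp Require Import measurable_realfun.

Set Implicit Arguments.
Unset Strict Implicit.
Unset Printing Implicit Defensive.
Import Order.TTheory GRing.Theory Num.Theory.
Import numFieldNormedType.Exports.

Local Open Scope classical_set_scope.
Local Open Scope ring_scope.
Local Open Scope ereal_scope.

Section lebesgue_Rn.
Context {R : realType} {n : nat}.

(* Half-open box  \prod_i ]a_i, b_i]; it is empty, of volume 0, as soon as
   b_i <= a_i for some i. *)
Definition box (a b : 'rV[R]_n.+1) : set 'rV[R]_n.+1 :=
  [set x | forall i, (a ord0 i < x ord0 i <= b ord0 i)%R].

Definition box_vol (a b : 'rV[R]_n.+1) : R :=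
  (\prod_(i < n.+1) Num.max 0 (b ord0 i - a ord0 i))%R.

(* Lebesgue outer measure: infimum of the total volume over countable covers
   by boxes. *)
Definition lebesgue_outer (A : set 'rV[R]_n.+1) : \bar R :=
  ereal_inf [set \sum_(k <oo) (box_vol (F k).1 (F k).2)%:E |
    F in [set F : nat -> 'rV[R]_n.+1 * 'rV[R]_n.+1 |
      A `<=` \bigcup_k box (F k).1 (F k).2]].

Lemma box_vol_ge0 a b : (0 <= box_vol a b)%R.
Proof. by apply: prodr_ge0 => i _; rewrite le_max lexx. Qed.

Lemma box_vol_id a : box_vol a a = 0%R.
Proof. by rewrite /box_vol (bigD1 ord0)//= subrr maxxx mul0r. Qed.

Lemma lebesgue_outer_ge0 A : 0 <= lebesgue_outer A.
Proof.
apply: le_ereal_inf_tmp => _ [F _ <-]; apply: nneseries_ge0 => k _ _.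
by rewrite lee_fin box_vol_ge0.
Qed.

Lemma lebesgue_outer0 : lebesgue_outer set0 = 0.
Proof.
apply/eqP; rewrite eq_le lebesgue_outer_ge0 andbT.
apply: ereal_inf_lbound; exists (fun=> (0%R, 0%R)) => //.
by rewrite eseries0// => k _ _; rewrite box_vol_id.
Qed.

Lemma le_lebesgue_outer :
  {homo lebesgue_outer : A B / A `<=` B >-> A <= B}.
Proof.
move=> A B AB; apply: le_ereal_inf_tmp => _ [F BF <-].
by apply: ereal_inf_lbound; exists F => //; exact: subset_trans BF.
Qed.

Lemma lebesgue_outer_sigma_subadditive : sigma_subadditive lebesgue_outer.
Proof.
move=> A; have [[i ioo]|] := pselect (exists i, lebesgue_outer (A i) = +oo).
  rewrite (eseries_pinfty _ _ ioo) ?leey// => k _.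
  by rewrite -ltNye (lt_le_trans _ (lebesgue_outer_ge0 _)).
rewrite -forallNE => Aoo.
suff add2e (e : {posnum R}) : lebesgue_outer (\bigcup_k A k) <=
    \sum_(i <oo) lebesgue_outer (A i) + e%:num%:E.
  by apply/lee_addgt0Pr => _/posnumP[].
apply: (le_trans _ (epsilon_trick _ _ _)) => //; last first.
  by move=> k; exact: lebesgue_outer_ge0.
pose v (F : 'rV[R]_n.+1 * 'rV[R]_n.+1) : \bar R := (box_vol F.1 F.2)%:E.
have v0 F : 0 <= v F by rewrite lee_fin box_vol_ge0.
pose P k (F : nat -> 'rV[R]_n.+1 * 'rV[R]_n.+1) :=
  A k `<=` \bigcup_j box (F j).1 (F j).2 /\
  \sum_(j <oo) v (F j) <= lebesgue_outer (A k) + (e%:num / (2 ^ k.+1)%:R)%:E.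
have [G PG] : {G & forall k, P k (G k)}.
  apply: (@choice _ _ P) => k.
  have fA : lebesgue_outer (A k) \is a fin_num.
    rewrite ge0_fin_numE ?lebesgue_outer_ge0// ltey; exact/eqP/Aoo.
  have en1 : (0 < e%:num / (2 ^ k.+1)%:R :> R)%R by [].
  have [_ [F AF <-] /ltW FA] := lb_ereal_inf_adherent en1 fA.
  by exists F.
have /card_esym/ppcard_eqP[f] := card_nat2.
have GE : \sum_(k <oo) v (G (f k).1 (f k).2) =
    \sum_(i <oo) \sum_(j <oo) v (G i j).
  rewrite [LHS]nneseries_esumT; last by move=> k; exact: v0.
  transitivity (\esum_(i in [set: nat * nat]) v (G i.1 i.2)).
    by rewrite [RHS](reindex_esum setT setT f)//.
  rewrite [RHS]nneseries_esumT; last by move=> *; exact: nneseries_ge0.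
  under [RHS]eq_esum do rewrite nneseries_esumT//.
  rewrite esum_esum//=; congr esum.
  by apply/seteqP; split.
apply: (@le_trans _ _ (\sum_(i <oo) \sum_(j <oo) v (G i j))).
  rewrite -GE; apply: ereal_inf_lbound.
  exists (fun k => G (f k).1 (f k).2) => //.
  move=> x [i _ /(PG i).1[j _ Gx]]; exists (f^-1%FUN (i, j)) => //=.
  by rewrite invK ?inE.
apply: lee_nneseries => [i _ _|i _]; first exact: nneseries_ge0.
exact: (PG i).2.
Qed.

HB.instance Definition _ := isOuterMeasure.Build R _ lebesgue_outer
  lebesgue_outer0 lebesgue_outer_ge0 le_lebesgue_outer
  lebesgue_outer_sigma_subadditive.

End lebesgue_Rn.

(* R^n for n >= 1, written with n.+1, equipped with the sigma-algebra of
   Lebesgue measurable sets, i.e. the sets that are Caratheodory measurable for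
   the Lebesgue outer measure; "measurable" on Rn means Lebesgue measurable. *)
Definition Rn (R : realType) (n : nat) : Type :=
  caratheodory_type (@lebesgue_outer R n).

HB.instance Definition _ (R : realType) (n : nat) := Measurable.copy (Rn R n)
  (caratheodory_type (@lebesgue_outer R n : {outer_measure set _ -> \bar R})).

Definition lebesgue_Rn (R : realType) (n : nat) : set (Rn R n) -> \bar R :=
  @lebesgue_outer R n.
Arguments lebesgue_Rn : clear implicits.

HB.instance Definition _ (R : realType) (n : nat) :=
  isMeasure.Build _ (Rn R n) R (lebesgue_Rn R n)
    (@caratheodory_measure0 _ _ (@lebesgue_outer R n))
    (@caratheodory_measure_ge0 _ _ (@lebesgue_outer R n))
    (@caratheodory_measure_sigma_additive _ _ (@lebesgue_outer R n)).

Section variable_exponents.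
Context {R : realType} {n : nat}.
Implicit Types p q : Rn R n -> \bar R.

Definition exponent p : Prop :=
  measurable_fun [set: Rn R n] p /\ forall x, 1 <= p x.

(* On \bar R, the inverse satisfies +oo^-1 = 0. *)
Definition conjugate_exponent p p' : Prop :=
  exponent p' /\ forall x, (p x)^-1 + (p' x)^-1 = 1.

(* Only used for r in [1, +oo] and 0 <= t; the value at r = -oo is junk. *)
Definition omega (r : \bar R) (t : R) : \bar R :=
  match r with
  | s%:E => (t `^ s)%:E
  | +oo => if (t <= 1)%R then 0 else +oo
  | -oo => 0
  end.

Definition modular p (f : Rn R n -> R) : \bar R :=
  \int[lebesgue_Rn R n]_x omega (p x) `|f x|%R.

(* l ^ (1 / q(x)), which is l ^ 0 = 1 when q(x) = +oo. *)
Definition root_exponent q (l : R) (x : Rn R n) : R :=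
  (l `^ fine (q x)^-1)%R.

Definition mixed_modular p q (f : nat -> Rn R n -> R) : \bar R :=
  \sum_(j <oo) ereal_inf [set l%:E | l in
    [set l : R | (0 < l)%R /\
                 modular p (fun x => f j x / root_exponent q l x)%R <= 1]].

Definition mixed_norm p q (f : nat -> Rn R n -> R) : \bar R :=
  ereal_inf [set m%:E | m in
    [set m : R | (0 < m)%R /\
                 mixed_modular p q (fun j x => f j x / m)%R <= 1]].

Definition mixed_space p q : set (nat -> Rn R n -> R) :=
  [set f | (forall j, measurable_fun [set: Rn R n] (f j)) /\
           mixed_norm p q f < +oo].

Definition mixed_unit_ball p q : set (nat -> Rn R n -> R) :=
  [set g | mixed_space p q g /\ mixed_norm p q g <= 1].

Definition dual_sup p' q' (f : nat -> Rn R n -> R) : \bar R :=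
  ereal_sup [set \int[lebesgue_Rn R n]_x \sum_(j <oo) (`|f j x| * `|g j x|)%:E |
    g in mixed_unit_ball p' q'].

End variable_exponents.

(* Main.v *)
(* With c1 = 1 and c2 = 16.  Upper bound: if f_j / l^(1/q) and g_j / k^(1/q')
   have modular at most 1, then l^(1/q) k^(1/q') <= l + k and Young's inequality
   give \int |f_j g_j| <= 2 (l + k), and one sums over j.
   Lower bound: if the mixed modular of f / m exceeds 1, pick weights l_j of
   total mass 1, each zero or strictly below the infimum defining the j-th term.
   Then h_j = f_j / (m l_j^(1/q)) has p-modular greater than 1, so the duality of
   L^p(.) and L^p'(.) on a sigma-finite space provides G_j in the unit modular
   ball of p' with \int |h_j| G_j >= 1.  The sequence g_j = l_j^(1/q') G_j lies
   in the unit ball and pairs with f to at least m, as l^(1/q) l^(1/q') = l. *)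
Require Import Defs.
From mathcomp Require Import all_boot all_order all_algebra.
From mathcomp Require Import all_classical all_reals all_analysis.
From mathcomp Require Import measurable_realfun.
From mathcomp Require Import ring lra.
Import Order.TTheory GRing.Theory Num.Theory.
Import numFieldNormedType.Exports.

Local Open Scope classical_set_scope.
Local Open Scope ring_scope.
Local Open Scope ereal_scope.

(** * Measurability of boxes and exhaustion of R^n by cubes of finite measure *)

Definition cut_low {R : realType} {n : nat} (i : 'I_n.+1) (c : R)
    (b : 'rV[R]_n.+1) : 'rV[R]_n.+1 :=
  (\row_j if j == i then Num.min (b ord0 j) c else b ord0 j)%R.
Definition cut_up {R : realType} {n : nat} (i : 'I_n.+1) (c : R)
    (a : 'rV[R]_n.+1) : 'rV[R]_n.+1 :=
  (\row_j if j == i then Num.max (a ord0 j) c else a ord0 j)%R.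

(** Only the factor of index [i] changes; there [max(0, min(b,c) - a) + max(0, b - max(a,c)) =
    max(0, b - a)], also when [c] lies outside [[a, b]] and one half is empty. *)
Lemma box_vol_cut {R : realType} {n : nat} (i : 'I_n.+1) (c : R)
    (a b : 'rV[R]_n.+1) :
  (box_vol a (cut_low i c b) + box_vol (cut_up i c a) b = box_vol a b)%R.
Proof.
rewrite /box_vol (bigD1 i)//= [X in (_ + X)%R](bigD1 i)//= [RHS](bigD1 i)//=.
rewrite !mxE eqxx.
under eq_bigr => j /negPf ji do rewrite mxE ji.
under [X in (_ + _ * X)%R]eq_bigr => j /negPf ji do rewrite mxE ji.
rewrite -mulrDl; congr (_ * _)%R.
case: (leP (b ord0 i) c) => bc; case: (leP (a ord0 i) c) => ac;
by do !case: leP => ?; lra.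
Qed.

(** The hyperplane [x_i = c] cuts a box cover of [X] into covers of the two parts of [X] with the
    same total volume, which gives Caratheodory's inequality. *)
Lemma measurable_halfspace {R : realType} {n : nat} (i : 'I_n.+1) (c : R) :
  measurable ([set x : 'rV[R]_n.+1 | (x ord0 i <= c)%R] : set (Rn R n)).
Proof.
apply: le_caratheodory_measurable => X.
apply: le_ereal_inf_tmp => _ [F XF <-].
rewrite (_ : \sum_(k <oo) _ =
   \sum_(k <oo) (box_vol (F k).1 (cut_low i c (F k).2))%:E +
   \sum_(k <oo) (box_vol (cut_up i c (F k).1) (F k).2)%:E); last first.
  rewrite -nneseriesD; [|by move=> *; rewrite lee_fin box_vol_ge0..].
  by apply: eq_eseriesr => k _; rewrite -EFinD box_vol_cut.
apply: leeD; apply: ereal_inf_lbound.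
- exists (fun k => ((F k).1, cut_low i c (F k).2)) => // x [/XF [k _ Fx] /= xc].
  exists k => // j; rewrite mxE; have /andP[-> xb] := Fx j.
  by case: eqP => [ji|//]; rewrite le_min xb ji xc.
- exists (fun k => (cut_up i c (F k).1, (F k).2)) => // x [/XF [k _ Fx] /= /negP].
  rewrite -ltNge => xc; exists k => // j; rewrite mxE; have /andP[xb ->] := Fx j.
  by case: eqP => [ji|_]; rewrite andbT// gt_max xb ji xc.
Qed.

Lemma measurable_box {R : realType} {n : nat} (a b : 'rV[R]_n.+1) :
  measurable (box a b : set (Rn R n)).
Proof.
rewrite (_ : box a b = \bigcap_(i in [set: 'I_n.+1])
  ([set x : 'rV[R]_n.+1 | (x ord0 i <= b ord0 i)%R] `\`
   [set x : 'rV[R]_n.+1 | (x ord0 i <= a ord0 i)%R])); last first.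
  apply/seteqP; split => x xab i.
    move=> _; have /andP[ax xb] := xab i; split => //=.
    by apply/negP; rewrite -ltNge.
  by have [/= -> /negP] := xab i I; rewrite -ltNge andbT.
apply: (@fin_bigcap_measurable _ (Rn R n)) => // i _.
by apply: (@measurableD _ (Rn R n)); exact: measurable_halfspace.
Qed.

Lemma lebesgue_outer_box_lty {R : realType} {n : nat} (a b : 'rV[R]_n.+1) :
  lebesgue_outer (box a b) < +oo.
Proof.
apply: (@le_lt_trans _ _ (box_vol a b)%:E); last exact: ltry.
apply: ereal_inf_lbound.
(* Beyond index 0 the cover continues with copies of [(a, a)], which have volume 0. *)
exists (fun k => if k == 0%N then (a, b) else (a, a)).
  by move=> x xab; exists 0%N.
rewrite (nneseries_split _ 1) /=; last by move=> *; rewrite lee_fin box_vol_ge0.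
rewrite add0n big_nat1/= eseries0 ?adde0// => -[|k] // _ _.
by rewrite /= box_vol_id.
Qed.

Definition cube (R : realType) (n m : nat) : set (Rn R n) :=
  box (const_mx (- m%:R)%R) (const_mx m%:R%R : 'rV[R]_n.+1).

Lemma measurable_cube (R : realType) (n m : nat) : measurable (cube R n m).
Proof. exact: measurable_box. Qed.

Lemma cube_lty (R : realType) (n m : nat) : lebesgue_Rn R n (cube R n m) < +oo.
Proof. exact: lebesgue_outer_box_lty. Qed.

Lemma bigcup_cube (R : realType) (n : nat) : \bigcup_m cube R n m = setT.
Proof.
apply/seteqP; split => // x _.
exists (Num.bound (\sum_i `|(x : 'rV[R]_n.+1) ord0 i|)%R) => // i.
rewrite !mxE.
set N := Num.bound _.
have : (`|(x : 'rV[R]_n.+1) ord0 i| < N%:R)%R.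
  apply: (le_lt_trans _ (archi_boundP _)); last by apply: sumr_ge0.
  by rewrite (bigD1 i)//= lerDl sumr_ge0.
by rewrite ltr_norml => /andP[-> /ltW].
Qed.

(** * Conjugate exponents and Young's inequality for [omega] *)

Lemma ge1_ereal_cases {R : realType} {r : \bar R} : 1 <= r ->
  r = +oo \/ exists2 s : R, (1 <= s)%R & r = s%:E.
Proof. by case: r => [s|_|//]; [right; exists s|left]. Qed.

(** Reduces pointwise claims on conjugate exponents to the two endpoint pairs and the classical
    range: if both are finite, their reciprocals are positive with sum 1, hence below 1. *)
Lemma conjugate_ereal_cases {R : realType} {r r' : \bar R} :
  1 <= r -> 1 <= r' -> r^-1 + r'^-1 = 1 ->
  [\/ r = 1 /\ r' = +oo, r = +oo /\ r' = 1 |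
      exists s t : R, [/\ r = s%:E, r' = t%:E, (1 < s)%R, (1 < t)%R &
                         (s^-1 + t^-1 = 1)%R]].
Proof.
move=> /ge1_ereal_cases[->|[s s1 ->]] /ge1_ereal_cases[->|[t t1 ->]].
- by rewrite invey adde0 => /esym/eqP; rewrite onee_eq0.
- by rewrite invey add0e => /eqP; rewrite inve_eq1 => /eqP ->; constructor 2.
- by rewrite invey adde0 => /eqP; rewrite inve_eq1 => /eqP ->; constructor 1.
- have s0 : (0 < s)%R by lra.
  have t0 : (0 < t)%R by lra.
  rewrite !inver !gt_eqF// -EFinD => -[st]; constructor 3; exists s, t.
  have is0 : (0 < s^-1)%R by rewrite invr_gt0.
  have it0 : (0 < t^-1)%R by rewrite invr_gt0.
  split => //; rewrite -invf_lt1//; lra.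
Qed.

Lemma omega_ge0 {R : realType} (r : \bar R) (t : R) : 0 <= omega r t.
Proof. by case: r => [s||]//=; [rewrite lee_fin powR_ge0|case: ifP]. Qed.

Lemma omega0 {R : realType} (r : \bar R) : 1 <= r -> omega r 0 = 0.
Proof.
move=> /ge1_ereal_cases[->|[s s1 ->]] /=; first by rewrite ler01.
by rewrite powR0// gt_eqF//; lra.
Qed.

(** In the classical range the factors [1/s] and [1/t] of Young's inequality are dropped, which
    leaves one bound for all cases. At an endpoint, [omega] with infinite exponent is either
    infinite or 0, and in the latter case its argument is at most 1. *)
Lemma omega_young {R : realType} (r r' : \bar R) (a b : R) :
  1 <= r -> 1 <= r' -> r^-1 + r'^-1 = 1 -> (0 <= a)%R -> (0 <= b)%R ->
  (a * b)%:E <= omega r a + omega r' b.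
Proof.
move=> r1 r'1 rr' a0 b0.
have [[-> ->]|[-> ->]|[s [t [-> -> s1 t1 st]]]] := conjugate_ereal_cases r1 r'1 rr'.
- rewrite /= powRr1//; case: ifP => [b1|_]; last by rewrite addey// leey.
  by rewrite adde0 lee_fin ler_piMr.
- rewrite /= powRr1//; case: ifP => [a1|_]; last by rewrite addye// leey.
  by rewrite add0e lee_fin ler_piMl.
- have s0 : (0 < s)%R by lra.
  have t0 : (0 < t)%R by lra.
  rewrite /= -EFinD lee_fin.
  apply: (le_trans (conjugate_powR a0 b0 s0 t0 st)).
  by apply: lerD; rewrite ler_pdivrMr// ler_peMr ?powR_ge0// ltW.
Qed.

(** * Measurability with variable exponents, and the weights [l^(1/q(x))] *)

Lemma measurable_fun_powR2 {d : measure_display} {T : measurableType d}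
    {R : realType} {f g : T -> R} :
  measurable_fun setT f -> measurable_fun setT g ->
  measurable_fun setT (fun x => f x `^ g x)%R.
Proof.
move=> mf mg; rewrite /powR; apply: measurable_fun_ifT.
- exact: measurable_fun_eqr.
(* At base 0, the power is 1 or 0 according to whether the exponent vanishes. *)
- rewrite (_ : (fun _ => _) = (fun x => if g x == 0%R then 1%R else 0%R)); last first.
    by apply/funext => x; case: eqP.
  by apply: measurable_fun_ifT => //; exact: measurable_fun_eqr.
- apply: measurableT_comp => //; apply: measurable_funM => //.
  by apply: measurableT_comp => //; exact: measurable_ln.
Qed.

Lemma measurable_fun_omega {d : measure_display} {T : measurableType d}
    {R : realType} {p : T -> \bar R} {u : T -> R} :
  measurable_fun setT p -> (forall x, 1 <= p x) -> measurable_fun setT u ->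
  measurable_fun setT (fun x => omega (p x) (u x)).
Proof.
move=> mp p1 mu; rewrite (_ : (fun _ => _) = (fun x => if p x == +oo then
   if (u x <= 1)%R then 0 else +oo else (u x `^ fine (p x))%:E)); last first.
  by apply/funext => x; have [->|[s s1 ->]] := ge1_ereal_cases (p1 x).
apply: measurable_fun_ifT; first exact: measurable_fun_eqe.
- by apply: measurable_fun_ifT => //; exact: measurable_fun_ler.
- apply/measurable_EFinP/measurable_fun_powR2 => //.
  exact: measurableT_comp.
Qed.

Lemma measurable_fun_inve_ge1 {d : measure_display} {T : measurableType d}
    {R : realType} {p : T -> \bar R} :
  measurable_fun setT p -> (forall x, 1 <= p x) ->
  measurable_fun setT (fun x => fine (p x)^-1).
Proof.
(* On finite values the reciprocal becomes the power [-1] of a positive number, so that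
   measurability of powers applies. *)
move=> mp p1; rewrite (_ : (fun _ => _) =
  (fun x => if p x == +oo then 0%R else (fine (p x) `^ (-1))%R)); last first.
  apply/funext => x; have [->|[s s1 ->]] := ge1_ereal_cases (p1 x).
    by rewrite invey.
  by rewrite /= powR_inv1 ?inver ?gt_eqF//=; lra.
apply: measurable_fun_ifT => //; first exact: measurable_fun_eqe.
by apply: measurable_fun_powR2 => //; exact: measurableT_comp.
Qed.

Lemma measurable_fun_root_exponent {R : realType} {n : nat}
    {q : Rn R n -> \bar R} (l : R) : exponent q ->
  measurable_fun setT (root_exponent q l).
Proof.
move=> [mq q1].
exact: (measurable_fun_powR2 (measurable_cst l) (measurable_fun_inve_ge1 mq q1)).
Qed.

Lemma root_exponentM {R : realType} {n : nat} {q q' : Rn R n -> \bar R} (l : R)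
    (x : Rn R n) : exponent q -> conjugate_exponent q q' -> (0 < l)%R ->
  (root_exponent q l x * root_exponent q' l x = l)%R.
Proof.
move=> [_ /(_ x) q1] [[_ /(_ x) q'1] /(_ x) qq'] l0.
rewrite /root_exponent -powRD; last by apply/implyP => _; rewrite gt_eqF.
rewrite -[RHS]powRr1 ?ltW//; congr (_ `^ _)%R.
have [[-> ->]|[-> ->]|[s [t [-> -> s1 t1 st]]]] := conjugate_ereal_cases q1 q'1 qq'.
- by rewrite inve1 invey addr0.
- by rewrite inve1 invey add0r.
- by rewrite !inver !gt_eqF//=; lra.
Qed.

Lemma root_exponent_le {R : realType} {n : nat} {q : Rn R n -> \bar R} (l k : R)
    (x : Rn R n) : exponent q -> (0 < l)%R -> (l <= k)%R ->
  (root_exponent q l x <= root_exponent q k x)%R.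
Proof.
move=> [_ /(_ x) q1] l0 lk; apply: ge0_ler_powR; rewrite ?nnegrE//; try lra.
by rewrite fine_ge0// inve_ge0; exact: le_trans q1.
Qed.

(** * Norming functions for the pairing of variable Lebesgue spaces with conjugate exponents *)

Lemma cvge_exists_gt {R : realType} {u : nat -> \bar R} {l a : \bar R} :
  u @ \oo --> l -> a < l -> exists i, a < u i.
Proof.
move=> ul al; apply: contrapT => /forallNP ua.
have : l <= a.
  rewrite -(cvg_lim _ ul)//; apply: lime_le; first by apply/cvg_ex; exists l.
  by apply: nearW => i; rewrite leNgt; exact/negP.
by rewrite leNgt al.
Qed.

(* The usual extremal t^(r-1) for the function t^r, rescaled so that it has
   r'-modular 1 when I is the integral of t^r. *)
Definition omega_dual {R : realType} (r : \bar R) (I t : R) : R :=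
  if r == +oo then 0%R else ((t / I `^ fine r^-1) `^ (fine r - 1))%R.

(** [I^-1 * omega r t] is a density squeezed between [omega r'] of the dual value and the product of
    that value with [t]. For finite [s > 1] the first bound is an equality, by [(s - 1) s' = s]; the
    second compares [I^(-1 + 1/s)] with [I^-1], where [1 < I] enters. For [r = +oo], finiteness of
    [omega r t] makes the density 0. *)
Lemma omega_dual_bounds {R : realType} (r r' : \bar R) (I t : R) :
  1 <= r -> 1 <= r' -> r^-1 + r'^-1 = 1 -> (1 < I)%R -> (0 <= t)%R ->
  omega r t < +oo ->
  omega r' (omega_dual r I t) <= (I^-1)%:E * omega r t /\
  (I^-1)%:E * omega r t <= (t * omega_dual r I t)%:E.
Proof.
move=> r1 r'1 rr' I1 t0.
have I0 : (0 < I)%R by lra.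
rewrite /omega_dual.
have [[-> ->]|[-> ->]|[s [s' [-> -> s1 s'1 ss']]]] := conjugate_ereal_cases r1 r'1 rr'.
- move=> _ /=; rewrite subrr powRr0 lexx powRr1//; split.
    by rewrite -EFinM lee_fin mulr_ge0// invr_ge0 ltW.
  by rewrite -EFinM lee_fin mulr1 ler_piMl// invf_le1// ltW.
- by move=> /=; case: ifP => // _ _; rewrite powR0// mule0 mulr0.
- clear r1 r'1 rr' => _ /=.
  have s0 : (0 < s)%R by lra.
  have s'0 : (0 < s')%R by lra.
  have Ir : (0 < I `^ s^-1)%R by rewrite powR_gt0.
  rewrite inver gt_eqF//= -!EFinM !lee_fin; split.
    rewrite -powRrM (_ : ((s - 1) * s' = s)%R); last first.
      have -> : (s' = s / (s - 1))%R.
        apply: (@mulIf _ (s'^-1)%R); first by rewrite invr_eq0 gt_eqF.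
        rewrite divff ?gt_eqF// (_ : s'^-1 = 1 - s^-1)%R; last by lra.
        by field; apply/andP; split; lra.
      by field; lra.
    rewrite powRM ?invr_ge0 ?powR_ge0// mulrC.
    rewrite -(powR_inv1 (powR_ge0 I s^-1)) -!powRrM.
    rewrite (_ : (s^-1 * (-1 * s) = -1)%R); last by field; lra.
    by rewrite powR_inv1// ltW.
  rewrite powRM ?invr_ge0 ?powR_ge0// mulrA mulr_powRB1// mulrC ler_wpM2l ?powR_ge0//.
  rewrite -(powR_inv1 (powR_ge0 I s^-1)) -!powRrM -(powR_inv1 (ltW I0)) ler_powR ?ltW//.
  rewrite (_ : (s^-1 * (-1 * (s - 1)) = -1 + s^-1)%R); last by field; lra.
  by rewrite ltrDl invr_gt0.
Qed.

Section norming.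
Context {d : measure_display} {T : measurableType d} {R : realType}.
Variable mu : {measure set T -> \bar R}.
Variables p p' : T -> \bar R.
Hypotheses (mp : measurable_fun setT p) (mp' : measurable_fun setT p').
Hypotheses (p1 : forall x, 1 <= p x) (p'1 : forall x, 1 <= p' x).
Hypothesis pp' : forall x, (p x)^-1 + (p' x)^-1 = 1.

(** Integrating the two pointwise bounds against the unit mass of [W] gives both claims; [g] is
    extended by 0 outside [S], where [omega] and the product then vanish. *)
Lemma norming_on (S : set T) (h g : T -> R) (W : T -> \bar R) :
  measurable S -> measurable_fun setT h -> measurable_fun setT g ->
  measurable_fun S W -> \int[mu]_(x in S) W x = 1 ->
  (forall x, 0 <= h x)%R -> (forall x, 0 <= g x)%R ->
  (forall x, S x -> omega (p' x) (g x) <= W x /\ W x <= (h x * g x)%:E) ->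
  exists G : T -> R, [/\ measurable_fun setT G, forall x, (0 <= G x)%R,
    \int[mu]_x omega (p' x) (G x) <= 1 & 1 <= \int[mu]_x (h x * G x)%:E].
Proof.
move=> mS mh mg mW IW h0 g0 SW.
have W0 x : S x -> 0 <= W x.
  by move=> /SW[+ _]; apply: le_trans; exact: omega_ge0.
have mWS : measurable_fun setT (W \_ S) by exact/(measurable_restrictT W mS).
have G0 x : (0 <= (g \_ S) x)%R by rewrite patchE; case: ifP.
have mG : measurable_fun setT (g \_ S).
  by apply/(measurable_restrictT g mS); exact: measurable_funS mg.
exists (g \_ S); split => //.
- rewrite -IW [leRHS]integral_mkcond; apply: ge0_le_integral => //.
  + by move=> x _; exact: omega_ge0.
  + exact: measurable_fun_omega.
  + move=> x _; rewrite !patchE; case: ifPn => [/set_mem/SW[]//|_].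
    by rewrite omega0.
- rewrite -IW integral_mkcond; apply: ge0_le_integral => //.
  + by move=> x _; apply: erestrict_ge0 => y; exact: W0.
  + by apply/measurable_EFinP; exact: measurable_funM.
  + move=> x _; rewrite !patchE; case: ifPn => [/set_mem/SW[]//|_].
    by rewrite mulr0.
Qed.

(** Two cases for [w = omega p h]. If [w] is finite almost everywhere, its integral over some set of
    finite measure on which [w] is bounded is finite and still exceeds 1, and [omega_dual] applies
    there. Otherwise [w] is infinite on a set of positive measure, where [p = +oo], [h > 1] and
    [p' = 1], and a normalised indicator suffices. *)
Lemma norming (h : T -> R) : sigma_finite setT mu ->
  measurable_fun setT h -> (forall x, 0 <= h x)%R ->
  1 < \int[mu]_x omega (p x) (h x) ->
  exists G : T -> R, [/\ measurable_fun setT G, forall x, (0 <= G x)%R,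
    \int[mu]_x omega (p' x) (G x) <= 1 & 1 <= \int[mu]_x (h x * G x)%:E].
Proof.
move=> /sigma_finiteP[F [FT ndF mF]] mh h0.
pose w x := omega (p x) (h x).
rewrite -/(w _) => w1.
have mw : measurable_fun setT w by exact: measurable_fun_omega.
have w0 x : 0 <= w x by exact: omega_ge0.
pose A := [set x | w x = +oo].
have mA : measurable A.
  rewrite [X in measurable X](_ : _ = setT `&` w @^-1` [set +oo]); last first.
    by apply/seteqP; split => x //= [].
  exact: mw.
have [A0|A0] := eqVneq (mu A) 0.
  pose S i := F i `&` [set x | w x <= i%:R%:E].
  have mS i : measurable (S i).
    apply: measurableI; first by have [] := mF i.
    by rewrite -[X in measurable X]setTI; exact: emeasurable_fun_infty_c.
  have SA : \bigcup_i S i = setT `\` A.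
    apply/seteqP; split => x.
      by move=> [i _ [_ /= wi]]; split => // wx; move: wi; rewrite wx leye_eq.
    move=> [_ /= wx]; have [i _ Fx] : (\bigcup_i F i) x by rewrite -FT.
    have wfin : w x \is a fin_num.
      by rewrite ge0_fin_numE// ltey; exact/eqP.
    exists (maxn i (Num.bound (fine (w x)))) => //; split => /=.
      by apply: (subsetPset _ _ (ndF _ _ _)) Fx; exact: leq_maxl.
    rewrite -[leLHS]fineK// lee_fin ltW//.
    apply: (lt_le_trans (archi_boundP _)); first by rewrite fine_ge0.
    by rewrite ler_nat leq_maxr.
  have ndS : nondecreasing_seq S.
    move=> i j ij; apply/subsetPset => x [Fx /= wx]; split.
      exact: (subsetPset _ _ (ndF _ _ ij)) Fx.
    by rewrite /= (le_trans wx)// lee_fin ler_nat.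
  have : \int[mu]_(x in S i) w x @[i --> \oo] --> \int[mu]_x w x.
    (* The sets [S i] exhaust only the complement of the null set [A], so [A] is removed before
       monotone convergence. *)
    rewrite (ge0_negligible_integral mA _ _ _ A0)// -SA.
    by apply: ge0_nondecreasing_set_cvg_integral => // i; exact: measurable_funS mw.
  move=> /cvge_exists_gt => /(_ _ w1)[i Si1].
  have mwS : measurable_fun (S i) w by exact: measurable_funS mw.
  have Sioo : \int[mu]_(x in S i) w x < +oo.
    apply: (@le_lt_trans _ _ (i%:R%:E * mu (S i))); last first.
      rewrite lte_mul_pinfty ?lee_fin//.
      apply: (le_lt_trans _ (mF i).2); apply: le_measure; rewrite ?inE//.
        by have [] := mF i.
      exact: subIsetl.
    rewrite -integral_cst//; apply: ge0_le_integral => //.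
    by move=> x [].
  have Sifin : \int[mu]_(x in S i) w x \is a fin_num.
    by rewrite ge0_fin_numE//; exact: integral_ge0.
  pose I := fine (\int[mu]_(x in S i) w x).
  have II : I%:E = \int[mu]_(x in S i) w x by rewrite fineK.
  have I1 : (1 < I)%R by rewrite -lte_fin II.
  apply: (@norming_on (S i) h (fun x => omega_dual (p x) I (h x))
    (fun x => (I^-1)%:E * w x)) => //.
  - apply: measurable_fun_ifT => //; first exact: measurable_fun_eqe.
    apply: measurable_fun_powR2; last first.
      by apply: measurable_funB => //; exact: measurableT_comp.
    apply: measurable_funM => //.
    rewrite (_ : (fun _ => _) = (fun x => (I `^ fine (p x)^-1) `^ (-1))%R); last first.
      by apply/funext => x; rewrite powR_inv1// powR_ge0.
    apply: measurable_fun_powR2 => //; apply: measurable_fun_powR2 => //.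
    exact: measurable_fun_inve_ge1.
  - exact: measurable_funeM.
  - rewrite ge0_integralZl//; last by rewrite lee_fin invr_ge0; lra.
    by rewrite -II -EFinM mulVf// gt_eqF//; lra.
  - by move=> x; rewrite /omega_dual; case: ifP => // _; exact: powR_ge0.
  - move=> x [_ /= wx]; apply: omega_dual_bounds => //.
    by apply: le_lt_trans wx _; exact: ltry.
(* Now [A] has positive measure; sigma-finiteness gives a piece of it of positive and finite
   measure. *)
have [i Ai] : exists i, 0 < mu (F i `&` A).
  apply: (@cvge_exists_gt _ (fun i => mu (F i `&` A)) (mu A)); last first.
    by rewrite lt0e A0/=.
  rewrite -[X in _ --> mu X]setTI FT setI_bigcupl.
  apply: nondecreasing_cvg_mu.
  - by move=> i; apply: measurableI => //; have [] := mF i.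
  - by apply: bigcupT_measurable => i; apply: measurableI => //; have [] := mF i.
  - move=> i j ij; apply/subsetPset; apply: setSI.
    exact: (subsetPset _ _ (ndF _ _ ij)).
have mFA : measurable (F i `&` A) by apply: measurableI => //; have [] := mF i.
have Aoo : mu (F i `&` A) < +oo.
  apply: (le_lt_trans _ (mF i).2); apply: le_measure; rewrite ?inE//.
    by have [] := mF i.
pose m := fine (mu (F i `&` A)).
have mE : m%:E = mu (F i `&` A) by rewrite fineK// ge0_fin_numE.
have m0 : (0 < m)%R by rewrite -lte_fin mE.
apply: (@norming_on (F i `&` A) h (cst m^-1)%R (cst (m^-1)%:E)) => //.
- by rewrite integral_cst// -mE -EFinM mulVf// gt_eqF.
- by move=> _ /=; rewrite invr_ge0 ltW.
- move=> x [_ Ax]; have := pp' x; move: Ax; rewrite /A/= /w.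
  have [->/=|[s s1 ->//]] := ge1_ereal_cases (p1 x).
  case: ifPn => // h1 _; rewrite invey add0e => /eqP; rewrite inve_eq1 => /eqP ->.
  have im0 : (0 <= m^-1)%R by rewrite invr_ge0 ltW.
  rewrite /= powRr1//; split => //.
  by rewrite lee_fin ler_peMl// ltW// ltNge.
Qed.

End norming.

Lemma sigma_finite_lebesgue_Rn (R : realType) (n : nat) :
  sigma_finite setT (lebesgue_Rn R n).
Proof.
exists (cube R n) => [|m]; first by rewrite bigcup_cube.
by split; [exact: measurable_cube|exact: cube_lty].
Qed.

(** * Hölder's inequality for modulars *)

(** Young's inequality integrated: two modulars at most 1 give the factor 2, and [K] absorbs the
    weights when [f] is compared with [u v]. *)
Lemma integral_omega_holder {d : measure_display} {T : measurableType d}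
    {R : realType} (mu : {measure set T -> \bar R}) {p p' : T -> \bar R}
    (f u v : T -> R) (K : R) :
  measurable_fun setT p -> measurable_fun setT p' ->
  (forall x, 1 <= p x) -> (forall x, 1 <= p' x) ->
  (forall x, (p x)^-1 + (p' x)^-1 = 1) ->
  measurable_fun setT f -> measurable_fun setT u -> measurable_fun setT v ->
  (0 <= K)%R -> (forall x, 0 <= u x)%R -> (forall x, 0 <= v x)%R ->
  (forall x, 0 <= f x <= K * (u x * v x))%R ->
  \int[mu]_x omega (p x) (u x) <= 1 -> \int[mu]_x omega (p' x) (v x) <= 1 ->
  \int[mu]_x (f x)%:E <= (K * 2)%:E.
Proof.
move=> mp mp' p1 p'1 pp' mf mu' mv K0 u0 v0 fK pu pv.
have mpu := measurable_fun_omega mp p1 mu'.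
have mpv := measurable_fun_omega mp' p'1 mv.
apply: (@le_trans _ _ (\int[mu]_x (K%:E * (omega (p x) (u x) + omega (p' x) (v x))))).
  apply: ge0_le_integral => //.
  - by move=> x _; rewrite lee_fin; have /andP[] := fK x.
  - exact/measurable_EFinP.
  - by apply: measurable_funeM; exact: emeasurable_funD.
  - move=> x _; apply: (@le_trans _ _ (K%:E * (u x * v x)%:E)).
      by rewrite -EFinM lee_fin; have /andP[] := fK x.
    by rewrite lee_wpmul2l ?lee_fin//; exact: omega_young.
rewrite ge0_integralZl//; last 2 first.
- exact: emeasurable_funD.
- by move=> x _; rewrite adde_ge0// omega_ge0.
rewrite EFinM lee_wpmul2l ?lee_fin//.
rewrite ge0_integralD//; try by move=> x _; exact: omega_ge0.
by rewrite (_ : 2%:E = 1 + 1)// leeD.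
Qed.

(** * Weights extracted from a series of infima *)

(** A finite sum makes every infimum finite, so [l j] can be taken within [1/2^(j+1)] of it; the
    errors add up to 1, whence the bound 2. *)
Lemma inf_series_choice {R : realType} (P : nat -> set R) :
  (forall j l, P j l -> 0 < l)%R ->
  \sum_(j <oo) ereal_inf [set l%:E | l in P j] <= 1 ->
  exists l : nat -> R, (forall j, P j (l j)) /\ \sum_(j <oo) (l j)%:E <= 2%:E.
Proof.
move=> P0; pose c j := ereal_inf [set l%:E | l in P j]; move=> c1.
have c0 j : 0 <= c j.
  by apply: le_ereal_inf_tmp => _ [l /P0 l0 <-]; rewrite lee_fin ltW.
have cfin j : c j \is a fin_num.
  rewrite ge0_fin_numE// ltey; apply/eqP => cj; move: c1.
  by rewrite (@nneseries_pinfty _ c xpredT j)// leye_eq.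
have /choice[l lP] : forall j, exists l, P j l /\
    (l%:E <= c j + (1 / (2 ^ j.+1)%:R)%:E).
  move=> j; have e0 : (0 < 1 / (2 ^ j.+1)%:R :> R)%R.
    by rewrite divr_gt0// ltr0n expn_gt0.
  have [_ [l Pl <-] /ltW lc] := lb_ereal_inf_adherent e0 (cfin j).
  by exists l.
exists l; split; first by move=> j; have [] := lP j.
apply: (@le_trans _ _ (\sum_(j <oo) (c j + (1 / (2 ^ j.+1)%:R)%:E))).
  apply: lee_nneseries => j _ => [_|]; last by have [] := lP j.
  by rewrite lee_fin ltW//; apply: (P0 j); have [] := lP j.
apply: (le_trans (epsilon_trick _ c0 ler01)).
by rewrite (_ : 2%:E = 1 + 1)// leeD2r.
Qed.

(** Truncation at [a] is subadditive: if one summand exceeds [a], its truncation alone reaches [a].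
    With [a = 2], a partial sum above 1 stays above 1 when its terms are truncated. *)
Lemma mine_sum_le {R : realType} (c : nat -> \bar R) (J : nat) (a : \bar R) :
  0 <= a -> (forall j, 0 <= c j) ->
  mine (\sum_(0 <= j < J) c j) a <= \sum_(0 <= j < J) mine (c j) a.
Proof.
move=> a0 c0; elim: J => [|J IH]; first by rewrite !big_geq// ge_min lexx.
rewrite !big_nat_recr//=; set S := \sum_(_ <= _ < _) c _.
have S0 : 0 <= S by apply: sume_ge0.
apply: (@le_trans _ _ (mine S a + mine (c J) a)); last by rewrite leeD2r.
have [Sa|aS] := leP S a; have [ca|ac] := leP (c J) a; rewrite ge_min.
- by rewrite lexx.
- by rewrite leeDr// orbT.
- by rewrite leeDl// orbT.
- by rewrite leeDl// orbT.
Qed.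

(* Truncating the infima at 2 keeps them finite without losing the lower bound 1;
   after normalisation to total mass 1 each weight lies strictly below its infimum. *)
Lemma inf_series_gt {R : realType} (P : nat -> set R) :
  (forall j l, P j l -> 0 < l)%R ->
  1 < \sum_(j <oo) ereal_inf [set l%:E | l in P j] ->
  exists l : nat -> R, [/\ forall j, (0 <= l j)%R,
    forall j, (0 < l j)%R -> ~ P j (l j) & \sum_(j <oo) (l j)%:E = 1].
Proof.
move=> P0; pose c j := ereal_inf [set l%:E | l in P j]; move=> c1.
have c0 j : 0 <= c j.
  by apply: le_ereal_inf_tmp => _ [l /P0 l0 <-]; rewrite lee_fin ltW.
(* A finite partial sum already exceeds 1, so the weights from index [J] on can be 0. *)
have /cvge_exists_gt/(_ c1)[J cJ] : \sum_(0 <= j < J) c j @[J --> \oo] -->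
    \sum_(j <oo) c j by exact: is_cvg_nneseries.
pose b j := fine (mine (c j) 2%:E).
have bE j : (b j)%:E = mine (c j) 2%:E.
  rewrite fineK// ge0_fin_numE; first by rewrite gt_min ltry orbT.
  by rewrite le_min c0 lee_fin ler0n.
have b0 j : (0 <= b j)%R by rewrite -lee_fin bE le_min c0 lee_fin ler0n.
pose S := (\sum_(0 <= j < J) b j)%R.
have S1 : (1 < S)%R.
  rewrite -lte_fin -sumEFin; under eq_bigr do rewrite bE.
  apply: (lt_le_trans _ (mine_sum_le c J 2%:E _ c0)); last by rewrite lee_fin ler0n.
  by rewrite lt_min cJ lte_fin ltr1n.
have S0 : (0 < S)%R by lra.
pose l j := if (j < J)%N then (b j / S)%R else 0%R.
have l0 j : (0 <= l j)%R by rewrite /l; case: ifP => // _; rewrite divr_ge0// ltW.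
exists l; split => //.
- move=> j; rewrite /l; case: ifP => [_|_]; last by rewrite ltxx.
  rewrite pmulr_lgt0 ?invr_gt0// => bj Pj.
  have : c j <= (b j / S)%:E by apply: ereal_inf_lbound; exists (b j / S)%R.
  apply/negP; rewrite -ltNge; apply: (@lt_le_trans _ _ (b j)%:E).
    by rewrite lte_fin ltr_pdivrMr// ltr_pMr.
  by rewrite bE ge_min lexx.
- rewrite (@nneseries_split _ _ 0 J)/=; last by move=> *; rewrite lee_fin.
  rewrite add0n [X in _ + X]eseries0 ?adde0; last first.
    by move=> j Jj _; rewrite /l ltnNge Jj.
  rewrite sumEFin; congr EFin.
  transitivity (S / S)%R; last by rewrite divff// gt_eqF.
  rewrite mulr_suml; apply: eq_big_nat => j /andP[_ jJ].
  by rewrite /l jJ.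
Qed.

(** * Hölder's inequality and norming for one term of the mixed modular *)

(** The set whose infimum is one term of [mixed_modular], named so that the choice lemmas apply by
    conversion. *)
Definition modular_levels {R : realType} {n : nat} (p q : Rn R n -> \bar R)
    (u : Rn R n -> R) : set R :=
  [set l : R | (0 < l)%R /\
               modular p (fun x => u x / root_exponent q l x)%R <= 1].

Lemma measurable_fun_div {d : measure_display} {T : measurableType d}
    {R : realType} {f g : T -> R} :
  measurable_fun setT f -> measurable_fun setT g -> (forall x, 0 <= g x)%R ->
  measurable_fun setT (fun x => f x / g x)%R.
Proof.
move=> mf mg g0; apply: measurable_funM => //.
rewrite (_ : (fun _ => _) = (fun x => g x `^ (-1))%R).
  exact: measurable_fun_powR2.
by apply/funext => x; rewrite powR_inv1.
Qed.

Lemma measurable_fun_norm_level {R : realType} {n : nat} {q : Rn R n -> \bar R}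
    (u : Rn R n -> R) (a l : R) : exponent q -> measurable_fun setT u ->
  measurable_fun setT (fun x => `|u x / a / root_exponent q l x|%R).
Proof.
move=> eq mu; apply: measurableT_comp; first exact: normr_measurable.
apply: measurable_fun_div; last by move=> x; exact: powR_ge0.
  by apply: measurable_funM; last exact: measurable_cst.
exact: measurable_fun_root_exponent.
Qed.

Lemma measurable_fun_normM {d : measure_display} {T : measurableType d}
    {R : realType} {f g : T -> R} :
  measurable_fun setT f -> measurable_fun setT g ->
  measurable_fun setT (fun x => `|f x| * `|g x|)%R.
Proof. by move=> mf mg; apply: measurable_funM; exact: measurableT_comp. Qed.

(** Hölder's inequality with [K = a b (l + k)]: the weights satisfy [l^(1/q) k^(1/q') <= (l +
    k)^(1/q) (l + k)^(1/q') = l + k], as the exponents add up to 1. *)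
Lemma level_holder {R : realType} {n : nat} {p q p' q' : Rn R n -> \bar R}
    (f g : Rn R n -> R) (a b l k : R) :
  exponent p -> exponent q ->
  conjugate_exponent p p' -> conjugate_exponent q q' ->
  measurable_fun setT f -> measurable_fun setT g -> (0 < a)%R -> (0 < b)%R ->
  modular_levels p q (fun x => f x / a)%R l ->
  modular_levels p' q' (fun x => g x / b)%R k ->
  \int[lebesgue_Rn R n]_x (`|f x| * `|g x|)%:E <= (a * b * (l + k) * 2)%:E.
Proof.
move=> ep eq cp cq mf mg a0 b0 [l0 fl] [k0 gk].
have lk0 : (0 < l + k)%R by lra.
have eq' : exponent q' by case: cq.
apply: (@integral_omega_holder _ _ _ (lebesgue_Rn R n) p p'
  (fun x => `|f x| * `|g x|)%R (fun x => `|f x / a / root_exponent q l x|)%R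
  (fun x => `|g x / b / root_exponent q' k x|)%R).
- exact: ep.1.
- exact: cp.1.1.
- exact: ep.2.
- exact: cp.1.2.
- exact: cp.2.
- exact: measurable_fun_normM.
- exact: measurable_fun_norm_level.
- exact: measurable_fun_norm_level.
- by rewrite !mulr_ge0// ltW.
- by move=> x; exact: normr_ge0.
- by move=> x; exact: normr_ge0.
- move=> x; rewrite mulr_ge0//=.
  set r := root_exponent q l x; set s := root_exponent q' k x.
  have r0 : (0 < r)%R by exact: powR_gt0.
  have s0 : (0 < s)%R by exact: powR_gt0.
  have rs : (r * s <= l + k)%R.
    rewrite -(root_exponentM (l + k)%R x eq cq lk0).
    apply: ler_pM; rewrite ?(ltW r0) ?(ltW s0)//;
      by apply: root_exponent_le => //; lra.
  have -> : (`|f x| * `|g x| =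
      a * b * (r * s) * (`|f x / a / r| * `|g x / b / s|))%R.
    rewrite !normrM !normfV (gtr0_norm a0) (gtr0_norm b0) (gtr0_norm r0).
    rewrite (gtr0_norm s0); field.
    by rewrite !gt_eqF.
  rewrite ler_wpM2r ?mulr_ge0//.
  by rewrite ler_wpM2l// mulr_ge0// ltW.
- exact: fl.
- exact: gk.
Qed.

(** As [l > 0], failure of the level means that [h = f / (m l^(1/q))] has modular above 1. If [G]
    norms [|h|], then [g = l^(1/q') G] is admissible at level [l], since division by the weight
    gives back [G], and [|f| g = m l |h| G]. *)
Lemma level_norming {R : realType} {n : nat} {p q p' q' : Rn R n -> \bar R}
    (f : Rn R n -> R) (m l : R) :
  exponent p -> exponent q ->
  conjugate_exponent p p' -> conjugate_exponent q q' ->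
  measurable_fun setT f -> (0 < m)%R -> (0 < l)%R ->
  ~ modular_levels p q (fun x => f x / m)%R l ->
  exists g : Rn R n -> R, [/\ measurable_fun setT g, modular_levels p' q' g l &
    (m * l)%:E <= \int[lebesgue_Rn R n]_x (`|f x| * `|g x|)%:E].
Proof.
move=> ep eq cp cq mf m0 l0 nlev.
have eq' : exponent q' by case: cq.
have big : 1 < modular p (fun x => f x / m / root_exponent q l x)%R.
  by rewrite ltNge; apply/negP => ?; apply: nlev.
have mh := measurable_fun_norm_level f m l eq mf.
have [G [mG G0 G1 hG]] := @norming _ _ _ (lebesgue_Rn R n) p p' ep.1 cp.1.1
  ep.2 cp.1.2 cp.2 _ (sigma_finite_lebesgue_Rn R n) mh
  (fun x => normr_ge0 _) big.
have mr := measurable_fun_root_exponent l eq'.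
exists (fun x => G x * root_exponent q' l x)%R; split.
- exact: measurable_funM.
- split => //; rewrite /modular.
  under eq_integral => x _ do
    rewrite mulfK ?gt_eqF ?powR_gt0// ger0_norm//.
  exact: G1.
- apply: (@le_trans _ _ ((m * l)%:E * \int[lebesgue_Rn R n]_x
    (`|f x / m / root_exponent q l x| * G x)%:E)).
    by rewrite -[leLHS]mule1 lee_wpmul2l// lee_fin mulr_ge0// ltW.
  rewrite -ge0_integralZl; last 4 first.
  + exact: measurableT.
  + by apply/measurable_EFinP; exact: measurable_funM.
  + by move=> x _; rewrite lee_fin mulr_ge0.
  + by rewrite lee_fin mulr_ge0// ltW.
  apply: ge0_le_integral.
  + exact: measurableT.
  + by move=> x _; rewrite -EFinM lee_fin !mulr_ge0// ltW.
  + by apply: measurable_funeM; apply/measurable_EFinP; exact: measurable_funM.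
  + apply/measurable_EFinP; apply: measurable_fun_normM; first exact: mf.
    exact: measurable_funM.
  + move=> x _; rewrite -EFinM lee_fin.
    set r := root_exponent q l x; set s := root_exponent q' l x.
    have r0 : (0 < r)%R by exact: powR_gt0.
    have s0 : (0 < s)%R by exact: powR_gt0.
    (* Writing [l] as the product of the two weights makes the integrands equal. *)
    rewrite -(root_exponentM l x eq cq l0) -/r -/s.
    rewrite !normrM !normfV (gtr0_norm m0) (gtr0_norm r0) (gtr0_norm s0).
    rewrite (ger0_norm (G0 x)) le_eqVlt; apply/orP; left; apply/eqP; field.
    by rewrite !gt_eqF.
Qed.

Lemma modular_levels0 {R : realType} {n : nat} {p q : Rn R n -> \bar R} (l : R) :
  exponent p -> (0 < l)%R -> modular_levels p q (fun=> 0%R) l.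
Proof.
move=> ep l0; split => //; rewrite /modular.
under eq_integral => x _ do rewrite mul0r normr0 (omega0 _ (ep.2 x)).
by rewrite integral0.
Qed.

(** * The two norm inequalities *)

(** Take [g j] from [level_norming] when [l j > 0] and [g j = 0] otherwise. The [j]-th term of the
    modular of [g] is at most [l j], so [g] lies in the unit ball, and the pairing integrates term
    by term. *)
Lemma dual_sup_ge {R : realType} {n : nat} {p q p' q' : Rn R n -> \bar R}
    (f : nat -> Rn R n -> R) (m : R) (l : nat -> R) :
  exponent p -> exponent q ->
  conjugate_exponent p p' -> conjugate_exponent q q' ->
  (forall j, measurable_fun setT (f j)) -> (0 < m)%R -> (forall j, 0 <= l j)%R ->
  (forall j, 0 < l j -> ~ modular_levels p q (fun x => f j x / m) (l j))%R ->
  \sum_(j <oo) (l j)%:E <= 1 ->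
  m%:E * \sum_(j <oo) (l j)%:E <= dual_sup p' q' f.
Proof.
move=> ep eq cp cq mf m0 l0 nlev suml.
have ep' : exponent p' by case: cp.
have /choice[g gP] : forall j, exists g : Rn R n -> R, [/\ measurable_fun setT g,
    ereal_inf [set k%:E | k in modular_levels p' q' g] <= (l j)%:E &
    (m * l j)%:E <= \int[lebesgue_Rn R n]_x (`|f j x| * `|g x|)%:E].
  move=> j; have := l0 j; rewrite le_eqVlt => /orP[/eqP lj|lj].
    exists (fun=> 0%R); split.
    - exact: measurable_cst.
    (* For the zero function every [e > 0] is admissible, so the infimum is at most 0 although 0
       itself is excluded. *)
    - rewrite -lj; apply/lee_addgt0Pr => e e0; rewrite add0e.
      by apply: ereal_inf_lbound; exists e => //; exact: modular_levels0.
    - by rewrite -lj mulr0; apply: integral_ge0 => x _; rewrite lee_fin mulr_ge0.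
  have [g [mg lg gI]] := level_norming (f j) m (l j) ep eq cp cq (mf j) m0 lj (nlev j lj).
  by exists g; split => //; apply: ereal_inf_lbound; exists (l j).
have g1 : mixed_norm p' q' g <= 1.
  apply: ereal_inf_lbound; exists 1%R => //; split => //.
  rewrite (_ : (fun _ _ => _) = g); last first.
    by apply/funext => j; apply/funext => x; rewrite divr1.
  apply: le_trans suml; apply: lee_nneseries => j _ => [_|].
    by apply: le_ereal_inf_tmp => _ [k [k0 _] <-]; rewrite lee_fin ltW.
  by have [] := gP j.
apply: (@le_trans _ _ (\int[lebesgue_Rn R n]_x
    \sum_(j <oo) (`|f j x| * `|g j x|)%:E)); last first.
  apply: ereal_sup_ubound; exists g => //; split => //; split.
    by move=> j; have [] := gP j.
  by apply: le_lt_trans g1 _; exact: ltry.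
rewrite integral_nneseries.
- rewrite -nneseriesZl; last by move=> j _; rewrite lee_fin.
  apply: lee_nneseries => j _ => [_|]; first by rewrite -EFinM lee_fin mulr_ge0// ltW.
  by rewrite -EFinM; have [] := gP j.
- exact: measurableT.
- move=> j; apply/measurable_EFinP; apply: measurable_fun_normM; first exact: mf.
  by have [] := gP j.
- by move=> j x _; rewrite lee_fin mulr_ge0.
Qed.

(** By contradiction: a number [m] strictly between the supremum and the norm leaves the modular of
    [f / m] above 1, and the resulting weights of total mass 1 force the supremum to be at least
    [m]. *)
Lemma mixed_norm_le_dual_sup {R : realType} {n : nat}
    {p q p' q' : Rn R n -> \bar R} (f : nat -> Rn R n -> R) :
  exponent p -> exponent q ->
  conjugate_exponent p p' -> conjugate_exponent q q' -> mixed_space p q f ->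
  mixed_norm p q f <= dual_sup p' q' f.
Proof.
move=> ep eq cp cq [mf foo].
have D0 : 0 <= dual_sup p' q' f.
  (* Zero weights show that the supremum is nonnegative, which makes the midpoint [m] below
     positive. *)
  have := @dual_sup_ge R n p q p' q' f 1%R (fun=> 0%R) ep eq cp cq mf ltr01.
  rewrite (_ : \sum_(j <oo) 0%:E = 0); last by rewrite eseries0.
  rewrite mule0; apply => //.
  by move=> j; rewrite ltxx.
have N0 : 0 <= mixed_norm p q f.
  by apply: le_ereal_inf_tmp => _ [k [k0 _] <-]; rewrite lee_fin ltW.
have NE : (fine (mixed_norm p q f))%:E = mixed_norm p q f.
  by rewrite fineK// ge0_fin_numE.
rewrite leNgt; apply/negP => DN.
have DE : (fine (dual_sup p' q' f))%:E = dual_sup p' q' f.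
  by rewrite fineK// ge0_fin_numE//; exact: lt_trans DN foo.
move: D0 DN; rewrite -DE -NE lee_fin lte_fin.
set D := fine _; set N := fine _ => D0 DN.
pose m := ((D + N) / 2)%R.
have [m0 Dm mN] : [/\ 0 < m, D < m & m < N]%R by rewrite /m; split; lra.
have : 1 < mixed_modular p q (fun j x => f j x / m)%R.
  rewrite ltNge; apply/negP => mm.
  have : mixed_norm p q f <= m%:E by apply: ereal_inf_lbound; exists m.
  by rewrite -NE lee_fin leNgt mN.
move=> /(@inf_series_gt _ (fun j => modular_levels p q (fun x => f j x / m)%R)).
move=> [|l [l0 nl l1]]; first by move=> j l [].
have := dual_sup_ge f m l ep eq cp cq mf m0 l0 nl.
by rewrite l1 mule1 -DE => /(_ (lexx _)); rewrite lee_fin leNgt Dm.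
Qed.

(** The constant is [2 * 2 * (2 + 2)]: one factor from [b <= 2], one from [integral_omega_holder],
    and the levels [l] and [k] each have sum at most 2. *)
Lemma dual_sup_le_mixed_norm {R : realType} {n : nat}
    {p q p' q' : Rn R n -> \bar R} (f : nat -> Rn R n -> R) :
  exponent p -> exponent q ->
  conjugate_exponent p p' -> conjugate_exponent q q' -> mixed_space p q f ->
  dual_sup p' q' f <= 16%:E * mixed_norm p q f.
Proof.
move=> ep eq cp cq [mf _].
apply: ge_ereal_sup => _ [g [[mg _] g1] <-].
(* The infimum defining the norm of [g] need not be attained; [b] is taken within 1 of it. *)
have [b [b0 gb] b2] : exists2 b : R, (0 < b)%R /\
    mixed_modular p' q' (fun j x => g j x / b)%R <= 1 & (b <= 2)%R.
  have gfin : mixed_norm p' q' g \is a fin_num.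
    rewrite ge0_fin_numE; first exact: le_lt_trans g1 (ltry _).
    by apply: le_ereal_inf_tmp => _ [k [k0 _] <-]; rewrite lee_fin ltW.
  have [_ [b [b0 gb] <-] b2] := lb_ereal_inf_adherent ltr01 gfin.
  exists b => //; rewrite -lee_fin (le_trans (ltW b2))//.
  by rewrite (_ : 2%:E = 1 + 1)// leeD2r.
(* The norm of [f] is an infimum too; it suffices to bound the pairing by [16 a] for each admissible
   [a]. *)
rewrite -lee_pdivrMl//; apply: le_ereal_inf_tmp => _ [a [a0 fa] <-].
rewrite lee_pdivrMl//.
have [l [lP l2]] := @inf_series_choice _
  (fun j => modular_levels p q (fun x => f j x / a)%R)
  (fun _ _ => @proj1 _ _) fa.
have [k [kP k2]] := @inf_series_choice _
  (fun j => modular_levels p' q' (fun x => g j x / b)%R)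
  (fun _ _ => @proj1 _ _) gb.
have l0 j : (0 <= l j)%R by rewrite ltW//; case: (lP j).
have k0 j : (0 <= k j)%R by rewrite ltW//; case: (kP j).
rewrite integral_nneseries; last 3 first.
- exact: measurableT.
- by move=> j; apply/measurable_EFinP; exact: measurable_fun_normM.
- by move=> j x _; rewrite lee_fin mulr_ge0.
apply: (@le_trans _ _ (\sum_(j <oo) ((a * b * 2)%:E * ((l j)%:E + (k j)%:E)))).
  apply: lee_nneseries => j _ => [_|].
    by apply: integral_ge0 => x _; rewrite lee_fin mulr_ge0.
  rewrite -EFinD -EFinM mulrAC.
  exact: (level_holder _ _ a b _ _ ep eq cp cq (mf j) (mg j) a0 b0 (lP j) (kP j)).
have ab0 : (0 <= a * b * 2)%R by rewrite !mulr_ge0// ltW.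
rewrite nneseriesZl; last by move=> j _; rewrite -EFinD lee_fin addr_ge0.
rewrite nneseriesD; [|by move=> *; rewrite lee_fin..].
apply: (@le_trans _ _ ((a * b * 2)%:E * (2%:E + 2%:E))).
  by rewrite lee_wpmul2l// leeD.
rewrite -EFinD -!EFinM lee_fin.
have : (a * b <= a * 2)%R by rewrite ler_wpM2l// ltW.
by lra.
Qed.

Theorem lemma3p3 (R : realType) (n : nat) (p q p' q' : Rn R n -> \bar R)
    (hp : exponent p) (hq : exponent q)
    (hp' : conjugate_exponent p p') (hq' : conjugate_exponent q q') :
  exists c1 c2 : R, [/\ (0 < c1)%R, (0 < c2)%R &
    forall f : nat -> Rn R n -> R, mixed_space p q f ->
      c1%:E * mixed_norm p q f <= dual_sup p' q' f /\
      dual_sup p' q' f <= c2%:E * mixed_norm p q f].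
Proof.
exists 1%R, 16%R; split => // f fpq; split.
  by rewrite mul1e; exact: (mixed_norm_le_dual_sup f hp hq).
exact: (dual_sup_le_mixed_norm f hp hq).
Qed.
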